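(* Let $\mathcal{A}$, $L$, $\mathcal{C}$, $\mathcal{A}_1$ be a web-like system (as described in the context), and let $u\in C^1([0,1],\ell^2(\mathcal{A}))$ be a solution of $$\partial_t u(t,\alpha)=i\sum_{\beta\in\mathcal{A}}L(\alpha,\beta)u(t,\beta),\qquad t\in[0,1],\ \alpha\in\mathcal{A}.$$ Set $\mathcal{F}=\mathcal{A}_1\cup\{\nu(1)\}_{\nu\in\mathcal{C}}$. Suppose there exists a subset $\mathcal{B}\subset\mathcal{F}$ such that, with $$\mathcal{B}'=\mathcal{B}\setminus\{\nu(1):\ \nu\in\mathcal{C},\ \nu(1)\in\mathcal{B}\text{ and }\nu(0)\notin\mathcal{B}\},$$ one has $[\mathcal{B}']=\mathcal{F}$ and $u(t,\beta)=0$ for all $\beta\in\mathcal{B}'$, $t\in[0,1]$. Then $u(t,\alpha)=0$ for all $t\in[0,1]$ and $\alpha\in\mathcal{A}$.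
   Context: Web-like system. $\mathcal{A}$ is a countable set (of ''particles'' or vertices) and $L=(L(\alpha,\beta))_{\alpha,\beta\in\mathcal{A}}$ is a real-valued symmetric matrix defining a positive selfadjoint operator $L:\ell^2(\mathcal{A})\to\ell^2(\mathcal{A})$. Two distinct vertices $\alpha,\beta$ are joined by an edge iff $L(\alpha,\beta)\ne0$; the resulting graph is connected. There is a finite set $\mathcal{C}=\{\nu_1,\dots,\nu_N\}$ of channels; each channel $\nu\in\mathcal{C}$ is an infinite sequence $\nu=\{\nu(k)\}_{k\ge0}$ of vertices with $L(\nu(k),\nu(n))=0$ if $|n-k|>1$, and for each $k\ge1$ the vertex $\nu(k)$ is joined by an edge to $\nu(k-1)$ and $\nu(k+1)$ and to no other vertex. Put $\mathcal{A}_0=\bigcup_{\nu\in\mathcal{C}}\bigcup_{k\ge1}\{\nu(k)\}$ (the vertices $\nu(k)$, $\nu\in\mathcal{C}$, $k\ge1$, being pairwise distinct) and $\mathcal{A}_1=\mathcal{A}\setminus\mathcal{A}_0$. The set $\mathcal{A}_1$ is finite, contains all $\nu(0)$, $\nu\in\mathcal{C}$, and the only pairs $(\alpha,\beta)\in\mathcal{A}_1\times\mathcal{A}_0$ with $L(\alpha,\beta)\neq0$ are $(\nu(0),\nu(1))$, $\nu\in\mathcal{C}$. For $\nu\in\mathcal{C}$ and $k\ge1$ write $-b_\nu(k-1)=L(\nu(k-1),\nu(k))$ and $a_\nu(k)=L(\nu(k),\nu(k))$. It is assumed that there is $K_0>0$ such that $b_\nu(k)=1$ and $a_\nu(k)=2$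 for all $k\ge K_0$ and all $\nu\in\mathcal{C}$. Extension of a subset. The finite set $\mathcal{F}$ is regarded as a graph $(\mathcal{F},\Pi)$ with edges $(\alpha,\beta)\in\Pi$ for $\alpha,\beta\in\mathcal{F}$, $\alpha\ne\beta$, $L(\alpha,\beta)\neq0$. For $\mathcal{D}\subset\mathcal{F}$: if $\beta\in\mathcal{D}$ is such that there is a unique $\alpha\in\mathcal{F}\setminus\mathcal{D}$ with $(\alpha,\beta)\in\Pi$, then $\mathcal{D}^{(1)}=\mathcal{D}\cup\{\alpha\}$ is called an extension of $\mathcal{D}$. Iterating, $\mathcal{D}^{(k+1)}=(\mathcal{D}^{(k)})^{(1)}$, one gets chains $\mathcal{D}\subset\mathcal{D}^{(1)}\subset\dots\subset\mathcal{D}^{(p)}$; if $\mathcal{D}^{(p)}$ has no extension it is called maximal. All maximal chains starting at $\mathcal{D}$ end with the same set, denoted $[\mathcal{D}]$. *)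

(* Defs.v *)
From HB Require Import structures.
From mathcomp Require Export all_boot all_order all_algebra.
From mathcomp Require Export all_classical all_reals all_analysis.
From mathcomp Require Import finmap.
From mathcomp Require Export complex.
From mathcomp.analysis.showcase Require summability.
Export numFieldNormedType.Exports.
Export Order.TTheory GRing.Theory Num.Theory.

Set Implicit Arguments.
Unset Strict Implicit.
Unset Printing Implicit Defensive.

Local Open Scope classical_set_scope.
Local Open Scope ring_scope.
Local Open Scope complex_scope.

Section ell2.
Variables (R : realType) (A : countType).
Implicit Types (v w : A -> R[i]) (L : A -> A -> R).

Definition sqnormc (z : R[i]) : R := complex.Re z ^+ 2 + complex.Im z ^+ 2.

Definition ell2 v : Prop := (\esum_(a in [set: A]) (sqnormc (v a))%:E < +oo)%E.

(* Meaningful when [ell2 v]; otherwise [fine] sends +oo to 0. *)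
Definition ell2_norm v : R :=
  Num.sqrt (fine (\esum_(a in [set: A]) (sqnormc (v a))%:E)%E).

(* Unconditional sums: the limit of the partial sums along the directed set of
   finite subsets of A. The type R[i]^o carries the usual topology of C. *)
Definition summing v (s : R[i]) : Prop :=
  summability.partial_sum (v : A -> R[i]^o) @ summability.totally --> (s : R[i]^o).

Definition csum v : R[i] := summability.sum (v : A -> R[i]^o).

Definition ell2_dot v w : R[i] := csum (fun a => v a * (w a)^*).

Definition mx_op L v : A -> R[i] :=
  fun a => csum (fun b => (L a b)%:C * v b).

(* An everywhere defined operator T on a Hilbert space is selfadjoint iff
   <T v, w> = <v, T w> for all v and w. The order of R[i] in the last clause is
   the partial order of C: 0 <= z means that z is real and nonnegative. *)
Record positive_selfadjoint L : Prop := PositiveSelfadjoint {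
  psa_cvg : forall v, ell2 v -> forall a,
    summing (fun b => (L a b)%:C * v b) (mx_op L v a);
  psa_stable : forall v, ell2 v -> ell2 (mx_op L v);
  psa_selfadjoint : forall v w, ell2 v -> ell2 w ->
    ell2_dot (mx_op L v) w = ell2_dot v (mx_op L w);
  psa_ge0 : forall v, ell2 v -> 0 <= ell2_dot (mx_op L v) v
}.

(* [u] is in C^1([0,1], l^2(A)) with derivative [du]: limits are in the norm of
   l^2(A) and one-sided at 0 and 1. *)
Record C1_ell2 (u du : R -> A -> R[i]) : Prop := C1Ell2 {
  C1_ell2_val : forall t : R, t \in `[0, 1] -> ell2 (u t);
  C1_ell2_der : forall t : R, t \in `[0, 1] -> ell2 (du t);
  C1_ell2_is_derive : forall t : R, t \in `[0, 1] ->
    ell2_norm (fun a => ((s - t)^-1)%:C * (u s a - u t a) - du t a)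
      @[s --> within `[0, 1] (t^')] --> (0 : R);
  C1_ell2_continuous : forall t : R, t \in `[0, 1] ->
    ell2_norm (fun a => du s a - du t a)
      @[s --> within `[0, 1] (nbhs t)] --> (0 : R)
}.

Definition C1_schrodinger_solution L (u : R -> A -> R[i]) : Prop :=
  exists2 du, C1_ell2 u du &
    forall (t : R) a, t \in `[0, 1] -> du t a = 'i * mx_op L (u t) a.

End ell2.

Section web.
Variables (R : realType) (A : countType) (L : A -> A -> R).

Definition edge : rel A := fun a b => (a != b) && (L a b != 0).

Section channels.
Variables (N : nat) (ch : 'I_N -> nat -> A).

Definition A0 : set A :=
  \bigcup_(nu in [set: 'I_N]) \bigcup_(k in [set k | (0 < k)%N]) [set ch nu k].

Definition A1 : set A := ~` A0.

Definition chan_b (nu : 'I_N) (k : nat) : R := - L (ch nu k) (ch nu k.+1).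
Definition chan_a (nu : 'I_N) (k : nat) : R := L (ch nu k) (ch nu k).

Record web_like : Prop := WebLike {
  web_sym : forall a b, L a b = L b a;
  web_psa : positive_selfadjoint L;
  web_connected : forall a b, exists2 p : seq A, path edge a p & last a p = b;
  web_channel : forall nu (k n : nat), (1 < `|(n%:Z - k%:Z)%R|)%N ->
    L (ch nu k) (ch nu n) = 0;
  web_channel_edges : forall nu (k : nat) a,
    edge (ch nu k.+1) a <-> a = ch nu k \/ a = ch nu k.+2;
  web_distinct : forall nu mu (k n : nat),
    ch nu k.+1 = ch mu n.+1 -> nu = mu /\ k = n;
  web_A1_finite : finite_set A1;
  web_A1_chan0 : forall nu, A1 (ch nu 0%N);
  web_A1_A0 : forall a b, A1 a -> A0 b ->
    (L a b != 0 <-> exists nu, a = ch nu 0%N /\ b = ch nu 1%N);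
  web_free : exists2 K0 : nat, (0 < K0)%N &
    forall nu (k : nat), (K0 <= k)%N -> chan_b nu k = 1 /\ chan_a nu k = 2
}.

Definition web_core : set A := A1 `|` [set ch nu 1%N | nu in [set: 'I_N]].

Definition web_trim (B : set A) : set A :=
  B `\` [set ch nu 1%N | nu in
           [set nu | B (ch nu 1%N) /\ ~ B (ch nu 0%N)]].

End channels.

Section extension.
Variable F : set A.
Implicit Types D E : set A.

Definition graph_edge (a b : A) : Prop := [/\ F a, F b & edge a b].

Definition extension D D' : Prop :=
  exists a b, [/\ D b, [set c | (F `\` D) c /\ graph_edge c b] = [set a]
                & D' = D `|` [set a]].

Inductive ext_chain D : set A -> Prop :=
| ExtChain0 : ext_chain D D
| ExtChainS E E' : ext_chain D E -> extension E E' -> ext_chain D E'.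

Definition maximal D : Prop := ~ exists D', extension D D'.

(* The set [D]: the end of the maximal chains starting at D. By
   [ext_closure_unique] and [ext_closureP] below, the choice made by [xget] is
   irrelevant and its default value is never used when F is finite. *)
Definition ext_closure D : set A :=
  xget D [set E | ext_chain D E /\ maximal E].

Lemma ext_chain_sub D E E' :
  ext_chain D E -> ext_chain D E' -> maximal E' -> E `<=` E'.
Proof.
move=> DE DE' maxE'.
have DsubE' : D `<=` E'.
  elim: DE' {maxE'} => // X X' _ DX [a [b [_ _ ->]]] x /DX Xx; by left.
elim: DE => // X X' _ XE' [a [b [Xb uniqa ->]]] x [/XE'//|->{x}].
apply: contrapT => nE'a; apply: maxE'.
have [[Fa _] ab] : (F `\` X) a /\ graph_edge a b.
  have : [set a] a by [].
  by rewrite -uniqa.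
exists (E' `|` [set a]), a, b; split => //; first exact: XE'.
apply/seteqP; split => [c [[Fc nE'c] cb]|_ ->] //.
by rewrite -uniqa; split => //; split => // /XE'.
Qed.

Lemma ext_closure_unique D E E' :
  ext_chain D E -> maximal E -> ext_chain D E' -> maximal E' -> E = E'.
Proof.
by move=> DE mE DE' mE'; apply/seteqP; split; exact: (@ext_chain_sub D).
Qed.

Lemma ext_closureP D : finite_set F ->
  ext_chain D (ext_closure D) /\ maximal (ext_closure D).
Proof.
move=> finF; have finD X : finite_set (F `\` X) by exact: finite_setD.
suff [E DE] : exists E, ext_chain D E /\ maximal E.
  by rewrite /ext_closure; case: xgetP => [E' _ //|/(_ E)].
suff H n : forall E, (#|` fset_set (F `\` E)| <= n)%N -> ext_chain D E ->
    exists E', ext_chain D E' /\ maximal E'.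
  by apply: (H _ D (leqnn _)); constructor.
elim: n => [|n IHn] E leE DE.
- exists E; split => // -[E' [a [b [_ uniqa _]]]].
  have [FEa _] : (F `\` E) a /\ graph_edge a b.
    have : [set a] a by [].
    by rewrite -uniqa.
  move: leE; rewrite leqn0 cardfs_eq0 => /eqP FE0.
  have : a \in fset_set (F `\` E).
    by rewrite in_fset_set ?mem_set.
  by rewrite FE0.
- have [[E' EE']|maxE] := pselect (exists E', extension E E'); last by exists E.
  apply: (IHn E'); last exact: ExtChainS EE'.
  rewrite -ltnS; apply: leq_trans leE.
  case: EE' => a [b [_ uniqa ->]].
  have [FEa _] : (F `\` E) a /\ graph_edge a b.
    have : [set a] a by [].
    by rewrite -uniqa.
  apply: fproper_ltn_card; rewrite fproperE; apply/andP; split.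
    apply/fsubsetP => x; rewrite !in_fset_set // => /set_mem[Fx nx].
    by apply: mem_set; split => // Ex; apply: nx; left.
  apply/negP => /fsubsetP/(_ a); rewrite !in_fset_set //.
  by move=> /(_ (mem_set FEa))/set_mem[_]; apply; right.
Qed.

End extension.
End web.

(* Main.v *)
Require Import Defs.
From mathcomp Require Import ring lra.
From mathcomp Require Import finmap.
Set Implicit Arguments.
Unset Strict Implicit.
Unset Printing Implicit Defensive.
Local Open Scope classical_set_scope.
Local Open Scope ring_scope.
Local Open Scope complex_scope.

(** If [u] vanishes at a vertex [b] for all times, so does its time derivative,
    and the equation at [b] reads [\sum_c L b c * u t c = 0]; hence [u] also
    vanishes at the only neighbour of [b] where this is not yet known. Along an
    extension chain in [web_core] this applies as long as a vertex [nu(1)] is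
    never used before [nu(0)] is reached, since [nu(1)] has the further
    neighbour [nu(2)] outside of [web_core]: this is what [web_trim] is for.
    Once [u] vanishes at [nu(0)] and [nu(1)], the same argument goes down the
    channel [nu]. *)

(** * Square-summable families and the equation at a single vertex *)

Section ell2_lemmas.
Variables (R : realType) (A : countType).
Implicit Types (v w : A -> R[i]).

Lemma sqnormc_ge0 (z : R[i]) : 0 <= sqnormc z.
Proof. by rewrite /sqnormc addr_ge0 ?sqr_ge0. Qed.

Lemma sqnormc_eq0 (z : R[i]) : (sqnormc z == 0) = (z == 0).
Proof. by rewrite /sqnormc paddr_eq0 ?sqr_ge0// !sqrf_eq0 eq_complex. Qed.

Lemma sqnormcN (z : R[i]) : sqnormc (- z) = sqnormc z.
Proof. by case: z => x y; rewrite /sqnormc /= !sqrrN. Qed.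

Lemma sqnormcZ (k : R) (z : R[i]) : sqnormc (k%:C * z) = k ^+ 2 * sqnormc z.
Proof. by case: z => x y; rewrite /sqnormc /= !mul0r subr0 addr0; ring. Qed.

Lemma sqnormcD_le (z z' : R[i]) :
  sqnormc (z + z') <= 2 * sqnormc z + 2 * sqnormc z'.
Proof.
by case: z z' => [x y] [x' y']; rewrite /sqnormc /=;
  have := sqr_ge0 (x - x'); have := sqr_ge0 (y - y'); lra.
Qed.

Lemma ell2N v : ell2 v -> ell2 (fun a => - v a).
Proof. by rewrite /ell2; under [in X in _ -> X]eq_esum do rewrite sqnormcN. Qed.

Lemma ell2Z (k : R) v : ell2 v -> ell2 (fun a => k%:C * v a).
Proof.
rewrite /ell2 => v2; have f0 a : (0 <= (sqnormc (v a))%:E)%E.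
  by rewrite lee_fin sqnormc_ge0.
have k0 : (0 <= (k ^+ 2)%:E)%E by rewrite lee_fin sqr_ge0.
apply: (@le_lt_trans _ _
    ((k ^+ 2)%:E * \esum_(a in [set: A]) (sqnormc (v a))%:E)%E).
  apply: ge_ereal_sup => _ [X finX <-].
  under eq_fsbigr do rewrite sqnormcZ EFinM.
  rewrite -ge0_mule_fsumr//; apply: lee_wpmul2l => //.
  by apply: esum_ge; exists X.
have fin : (\esum_(a in [set: A]) (sqnormc (v a))%:E)%E \is a fin_num.
  by rewrite ge0_fin_numE ?esum_ge0.
by rewrite -(fineK fin) -EFinM ltry.
Qed.

Lemma ell2D v w : ell2 v -> ell2 w -> ell2 (fun a => v a + w a).
Proof.
move=> v2 w2.
pose f v' a := (sqnormc (v' a))%:E.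
have f0 v' a : (0 <= f v' a)%E by rewrite lee_fin sqnormc_ge0.
apply: (@le_lt_trans _ _
    (\esum_(a in [set: A]) ((f v a + f v a) + (f w a + f w a))%E)).
  apply: le_esum => a _; rewrite -!EFinD lee_fin.
  by apply: (le_trans (sqnormcD_le _ _)); lra.
rewrite !esumD => [|a _|a _|a _|a _|a _|a _]; rewrite ?adde_ge0//.
by rewrite !lte_add_pinfty.
Qed.

Lemma sqnormc_le_ell2_norm v a : ell2 v -> sqnormc (v a) <= ell2_norm v ^+ 2.
Proof.
move=> v2; have v0 b : (0 <= (sqnormc (v b))%:E)%E.
  by rewrite lee_fin sqnormc_ge0.
rewrite sqr_sqrtr ?fine_ge0 ?esum_ge0// -lee_fin fineK; last first.
  by rewrite ge0_fin_numE ?esum_ge0.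
apply: esum_ge; exists [set a]; first by split.
by rewrite fsbig_set1.
Qed.

(** Every partial sum over a finite set containing [a] equals [v a], so the net of partial sums is
    eventually constant. *)
Lemma csum_single v a : (forall b, b != a -> v b = 0) -> csum v = v a.
Proof.
move=> va; rewrite /csum /summability.sum.
have tF := @summability.totally_filter A.
apply: (@norm_lim_near_cst _ (R[i]^o : normedModType R[i])).
exists [fset a]%fset => // J /= aJ.
rewrite /summability.partial_sum.
have aJ' : a \in J by apply: (fsubsetP aJ); rewrite inE.
rewrite (bigD1 [` aJ']%fset)//= big1 ?addr0// => b ba.
by apply: va; apply: contraNneq ba => bE; apply/eqP/val_inj.
Qed.

(** Properness is what lets inequalities pass to the limit of difference quotients; [t < 1] is
    approached from the right, [t = 1] from the left. *)
Lemma unit_itv_dnbhs_proper (t : R) : t \in `[0, 1] ->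
  ProperFilter (within `[0, 1]%classic (t^')).
Proof.
rewrite in_itv /= => /andP[t0 t1].
split; last exact: within_filter.
rewrite /within /= /dnbhs /within /= => Ft.
have [t_lt1|t_ge1] := ltP t 1.
- have : \forall s \near t^'+, False.
    near=> s; have ts : t < s by [].
    have st1 : s < 1 by near: s; exact: nbhs_right_lt.
    have : s != t -> `[0, 1]%classic s -> False.
      by near: s; apply: cvg_within; exact: Ft.
    by apply; rewrite ?gt_eqF//= in_itv/= (ltW st1) (le_trans t0 (ltW ts)).
  by move=> /filter_ex[].
- have : \forall s \near t^'-, False.
    near=> s; have ts : s < t by [].
    have s0 : 0 < s by near: s; apply: nbhs_left_gt; exact: lt_le_trans t_ge1.
    have : s != t -> `[0, 1]%classic s -> False.
      by near: s; apply: cvg_within; exact: Ft.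
    by apply; rewrite ?lt_eqF//= in_itv/= (ltW s0) (le_trans (ltW ts) t1).
  by move=> /filter_ex[].
Unshelve. all: by end_near. Qed.

(** The difference quotient of [u] is 0 at [a], so the squared modulus of [du t a] is at most the
    squared l^2 norm of quotient minus derivative, which tends to 0. *)
Lemma C1_ell2_deriv_eq0 (u du : R -> A -> R[i]) (a : A) : C1_ell2 u du ->
  (forall t, t \in `[0, 1] -> u t a = 0) ->
  forall t, t \in `[0, 1] -> du t a = 0.
Proof.
move=> uC1 ua0 t t01; apply/eqP; rewrite -sqnormc_eq0 eq_le sqnormc_ge0 andbT.
have PF := unit_itv_dnbhs_proper t01.
have := C1_ell2_is_derive uC1 t01.
set q := (fun s => ell2_norm _) => q0.
have qq0 : q s * q s @[s --> within `[0, 1]%classic (t^')] --> (0 : R).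
  by rewrite -[X in _ --> X](mulr0 0); exact: cvgM.
rewrite -(cvg_lim (@norm_hausdorff _ _) qq0).
apply: limr_ge; first exact: cvgP qq0.
rewrite near_withinE; near=> s => s01.
have {}s01 : s \in `[0, 1] by [].
have := @sqnormc_le_ell2_norm
  (fun a => ((s - t)^-1)%:C * (u s a - u t a) - du t a) a.
rewrite /= !ua0// subrr mulr0 sub0r sqnormcN expr2; apply.
(* The bound needs square-summability, because [ell2_norm] is 0 on a divergent sum. *)
apply: ell2D; last exact/ell2N/(C1_ell2_der uC1).
apply/ell2Z/ell2D; first exact: (C1_ell2_val uC1).
exact/ell2N/(C1_ell2_val uC1).
Unshelve. all: by end_near. Qed.

(** The derivative at [b] is zero, so the sum of [L b c * u t c] over [c] is zero; its only
    remaining term is [L b a * u t a]. *)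
Lemma schrodinger_propagation (L : A -> A -> R) (u : R -> A -> R[i]) (b a : A) :
  C1_schrodinger_solution L u ->
  (forall t, t \in `[0, 1] -> u t b = 0) -> L b a != 0 ->
  (forall t c, t \in `[0, 1] -> c != a -> L b c != 0 -> u t c = 0) ->
  forall t, t \in `[0, 1] -> u t a = 0.
Proof.
move=> [du uC1 eq_du] ub Lba uc t t01.
have := eq_du t b t01; rewrite (C1_ell2_deriv_eq0 uC1 ub t01) /mx_op.
rewrite (@csum_single _ a) => [/esym/eqP|c ca]; last first.
  have [->|Lbc] := eqVneq (L b c) 0; first by rewrite mul0r.
  by rewrite uc ?mulr0.
rewrite mulf_eq0 (negPf (neq0Ci _))/= mulf_eq0 => /orP[|/eqP//].
by rewrite eq_complex/= (negPf Lba).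
Qed.

End ell2_lemmas.

(** * Propagation along extension chains and down the channels *)

Section web_lemmas.
Variables (R : realType) (A : countType) (L : A -> A -> R).
Variables (N : nat) (ch : 'I_N -> nat -> A).
Hypothesis web : web_like L ch.

Lemma edge_sym a b : edge L a b = edge L b a.
Proof. by rewrite /edge eq_sym (web_sym web). Qed.

Lemma A0_chanS nu k : A0 ch (ch nu k.+1).
Proof. by exists nu => //; exists k.+1. Qed.

Lemma chan0_neq_chanS nu mu k : ch nu 0%N <> ch mu k.+1.
Proof.
by move=> e; apply: (web_A1_chan0 web (nu := nu)); rewrite e; exact: A0_chanS.
Qed.

Lemma web_core_chanSS nu k : ~ web_core ch (ch nu k.+2).
Proof.
move=> [nA0|[mu _ /(web_distinct web)[_ //]]]; apply: nA0; exact: A0_chanS.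
Qed.

Lemma web_core_finite : finite_set (web_core ch).
Proof.
rewrite finite_setU; split; first exact: web_A1_finite web.
exact: finite_image.
Qed.

Lemma web_core_A1_edge a b : A1 ch a -> edge L a b -> web_core ch b.
Proof.
move=> A1a /andP[_ Lab]; have [A0b|] := pselect (A0 ch b); last by left.
by have [/(_ Lab)[nu [_ ->]] _] := web_A1_A0 web A1a A0b; right; exists nu.
Qed.

Lemma web_core_chan1_edge nu b :
  web_core ch b -> edge L (ch nu 1%N) b -> b = ch nu 0%N.
Proof.
move=> Fb /(web_channel_edges web)[//|bE].
by move: Fb; rewrite bE => /web_core_chanSS.
Qed.

(** An invariant of extension chains: as [nu(0)] is the only neighbour of [nu(1)] in the core, no
    extension can start from [nu(1)]. *)
Definition chan_closed (D : set A) :=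
  forall nu, D (ch nu 1%N) -> D (ch nu 0%N).

Lemma chan_closed_trim (B : set A) : chan_closed (web_trim ch B).
Proof.
(* [nu(0)] is never trimmed away, since it differs from every [mu(1)]. *)
move=> nu [B1 nB]; split; last by move=> [mu _ /esym/chan0_neq_chanS].
by apply: contrapT => nB0; apply: nB; exists nu.
Qed.

(** A new vertex [nu(1)] can only be reached from its core neighbour [nu(0)], which is then already
    in [D]. *)
Lemma chan_closed_extension D D' : D `<=` web_core ch ->
  chan_closed D -> extension L (web_core ch) D D' -> chan_closed D'.
Proof.
move=> DF clD [a [b [Db uniqa ->]]] nu [/clD|E]; first by left.
have [_ [_ Fb ab]] : (web_core ch `\` D) a /\ graph_edge L (web_core ch) a b.
  by have : [set a] a by []; rewrite -uniqa.
by left; rewrite -(web_core_chan1_edge Fb (nu := nu))// E.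
Qed.

Variable u : R -> A -> R[i].
Hypothesis sol : C1_schrodinger_solution L u.

Definition vanishes_on (D : set A) :=
  forall a, D a -> forall t, t \in `[0, 1] -> u t a = 0.

Lemma vanishes_on_extension D D' : D `<=` web_core ch -> chan_closed D ->
  extension L (web_core ch) D D' -> vanishes_on D -> vanishes_on D'.
Proof.
move=> DF clD [a [b [Db uniqa ->]]] uD c [/uD//|->{c}].
have [[Fa nDa] [_ Fb ab]] :
    (web_core ch `\` D) a /\ graph_edge L (web_core ch) a b.
  by have : [set a] a by []; rewrite -uniqa.
(* If [b] were some [nu(1)], then [a] would be [nu(0)], which [chan_closed] already puts in [D]. *)
have A1b : A1 ch b.
  case: Fb => // -[nu _ bE]; exfalso; apply: nDa.
  rewrite (@web_core_chan1_edge nu a)//; last by rewrite bE edge_sym.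
  by apply: clD; rewrite bE.
apply: (schrodinger_propagation sol (uD _ Db)).
  by move: ab; rewrite edge_sym => /andP[].
move=> t c t01 ca Lbc.
(* The diagonal term is not an edge and is treated apart. Any other [c] is a core neighbour of [b],
   so it lies in [D] by uniqueness of [a]. *)
have [<-|bc] := eqVneq b c; first exact: uD.
have Ebc : edge L b c by rewrite /edge bc Lbc.
have Fc := web_core_A1_edge A1b Ebc.
have [Dc|nDc] := pselect (D c); first exact: uD.
have : [set a] c by rewrite -uniqa; split=> //; split => //; rewrite edge_sym.
by move=> /= cE; rewrite cE eqxx in ca.
Qed.

Lemma vanishes_on_ext_chain D E : D `<=` web_core ch -> chan_closed D ->
  vanishes_on D -> ext_chain L (web_core ch) D E -> vanishes_on E.
Proof.
move=> DF clD uD DE.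
suff [] : [/\ E `<=` web_core ch, chan_closed E & vanishes_on E] by [].
elim: DE => // X X' _ [XF clX uX] XX'; split.
- case: XX' => a [b [_ uniqa ->]] c [/XF//|->].
  have [[]//] : (web_core ch `\` X) a /\ graph_edge L (web_core ch) a b.
  by have : [set a] a by []; rewrite -uniqa.
- exact: chan_closed_extension XX'.
- exact: vanishes_on_extension XX' uX.
Qed.

Lemma vanishes_on_core_setT : vanishes_on (web_core ch) -> vanishes_on setT.
Proof.
move=> uF a _; have [[nu _ [k /= _ ->]]|A1a] := pselect (A0 ch a); last first.
  by apply: uF; left.
(* Consecutive vertices go in pairs: the equation at [nu(k+1)] yields [nu(k+2)] once [nu(k)] and
   [nu(k+1)] are both known. *)
suff : (forall t, t \in `[0, 1] -> u t (ch nu k) = 0) /\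
       (forall t, t \in `[0, 1] -> u t (ch nu k.+1) = 0) by case.
elim: k => [|k [uk uk1]].
  split; apply: uF; first by left; exact: web_A1_chan0 web _.
  by right; exists nu.
split=> //; apply: (schrodinger_propagation sol uk1).
  have /andP[] // : edge L (ch nu k.+1) (ch nu k.+2).
  by apply/(web_channel_edges web); right.
move=> t c t01 ck2 Lc; have [<-|kc] := eqVneq (ch nu k.+1) c; first exact: uk1.
have : edge L (ch nu k.+1) c by rewrite /edge kc.
by move=> /(web_channel_edges web)[->|cE]; [exact: uk|rewrite cE eqxx in ck2].
Qed.

End web_lemmas.

Theorem corollary4p2 (R : realType) (A : countType) (L : A -> A -> R)
    (N : nat) (ch : 'I_N -> nat -> A) (u : R -> A -> R[i]) (B : set A) :
  web_like L ch ->
  C1_schrodinger_solution L u ->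
  B `<=` web_core ch ->
  ext_closure L (web_core ch) (web_trim ch B) = web_core ch ->
  (forall (t : R) (b : A), t \in `[0, 1] -> web_trim ch B b -> u t b = 0) ->
  forall (t : R) (a : A), t \in `[0, 1] -> u t a = 0.
Proof.
move=> web sol BF clB uB t a.
apply: (vanishes_on_core_setT web sol) => //.
rewrite -clB.
apply: (@vanishes_on_ext_chain _ _ _ _ _ web _ sol (web_trim ch B)).
- by move=> b [Bb _]; exact: BF.
- exact: (chan_closed_trim web).
- by move=> b Bb s s01; exact: uB.
(* Finiteness of the core makes [ext_closure] the end of an actual chain, not the default of
   [xget]. *)
- exact: (ext_closureP L _ (web_core_finite web)).1.
Qed.
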